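(* Let $(W,S)$ be a Coxeter system of finite rank with Coxeter matrix $(m(s,t))_{s,t\in S}$. Let $N_e$ be the normal closure in $W$ of all the elements $ab$ with $a,b\in S$ and $m(a,b)$ odd, together with all the elements $(ab)^2$ such that $(a,b)$ is a special pair of elements of $S$. Let $W_e=W/N_e$, let $\eta:W\to W_e$ be the quotient homomorphism, and let $S_e=\eta(S)$. Then the pair $(W_e,S_e)$ is a Coxeter system such that if $s$ and $t$ are in $S$, then $\eta(s)=\eta(t)$ if and only if $s$ and $t$ are conjugate in $W$. If $s$ and $t$ are nonconjugate elements of $S$, then the order of $\eta(s)\eta(t)$ is the greatest common divisor of the set of all $\overline{m}(u,v)$ such that $u$ and $v$ are in $S$, $u$ is conjugate to $s$ in $W$, and $v$ is conjugate to $t$ in $W$. In particular, the order of $\eta(s)\eta(t)$ is either even or $\infty$.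
   Context: A Coxeter matrix is a symmetric matrix $M=(m(s,t))_{s,t\in S}$ with each $m(s,t)$ a positive integer or $\infty$, and $m(s,t)=1$ if and only if $s=t$. A Coxeter system with Coxeter matrix $M$ is a pair $(W,S)$ where $W$ is a group generated by $S\subset W$ with presentation $W=\langle S \mid (st)^{m(s,t)} : s,t\in S,\ m(s,t)<\infty\rangle$; then $m(s,t)$ is the order of $st$ in $W$. The rank of $(W,S)$ is the cardinality of $S$. A pair $(a,b)$ of elements of $S$ is special if $m(a,b)<\infty$, $m(a,b)\equiv 2 \pmod 4$, and either $v=a$ or $v=b$ has the property that for every $s\in S-\{a,b\}$ with $m(s,v)<\infty$ one has $m(s,a)=m(s,b)=2$. For $a,b\in S$, define $\overline{m}(a,b)=2$ if $(a,b)$ is special, and $\overline{m}(a,b)=m(a,b)$ otherwise. Convention: the greatest common divisor of a set of elements of $\{1,2,3,\dots\}\cup\{\infty\}$ is the greatest common divisor of its finite elements, and is $\infty$ if all its elements are $\infty$. *)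

(* Defs.v *)
From HB Require Import structures.
From mathcomp Require Export all_boot.
From mathcomp Require Export boolp classical_sets cardinality.

Set Implicit Arguments.
Unset Strict Implicit.
Unset Printing Implicit Defensive.

Local Open Scope classical_set_scope.
Local Open Scope group_scope.

Section Groups.
Context {G : groupType}.
Implicit Types (x y z : G) (A N : set G).

Definition conjugate x y : Prop := exists z, x ^ z = y.

(* The order of x in {1, 2, 3, ...} together with infinity, which throughout
   is encoded as option nat, with None standing for infinity. *)
Definition order x : option nat :=
  match pselect (exists n, (0 < n)%N && (x ^+ n == 1)) with
  | left ex_n => Some (ex_minn ex_n)
  | right _ => None
  end.

Definition normal N : Prop :=
  group_closed [in N] /\ forall x y, N x -> N (x ^ y).

End Groups.

Record normal_subgroup (G : groupType) := NormalSubgroup {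
  normal_subgroup_set :> set G;
  normal_subgroupP : normal normal_subgroup_set }.

Lemma normal_smallest (G : groupType) (A : set G) : normal (smallest normal A).
Proof.
split; first split.
- by apply/mem_set => N [[[N1 _] _] _]; exact: set_mem.
- move=> x y /set_mem xA /set_mem yA; apply/mem_set => N /[dup] N' [[[_ ND] _] _].
  by apply/set_mem/ND; apply/mem_set; [exact: xA | exact: yA].
- by move=> x y xA N /[dup] N' [[_ NJ] _]; apply: NJ; exact: xA.
Qed.

Definition normal_closure (G : groupType) (A : set G) : normal_subgroup G :=
  NormalSubgroup (normal_smallest A).

Section Quotient.
Local Open Scope quotient_scope.
Variables (G : groupType) (N : normal_subgroup G).
Implicit Types x y z : G.

Local Notation P := (normal_subgroup_set N).

Let N1 : P 1.
Proof. by case: (normal_subgroupP N) => [[/set_mem]]. Qed.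

Let ND x y : P x -> P y -> P (x / y).
Proof.
case: (normal_subgroupP N) => [[_ ND] _] Nx Ny.
by apply/set_mem/ND; exact/mem_set.
Qed.

Let NV x : P x -> P x^-1.
Proof. by move=> Nx; rewrite -[x^-1]mul1g; exact: ND. Qed.

Let NM x y : P x -> P y -> P (x * y).
Proof. by move=> Nx Ny; rewrite -[y]invgK; apply: ND => //; exact: NV. Qed.

Let NJ x y : P x -> P (x ^ y).
Proof. by case: (normal_subgroupP N) => _; apply. Qed.

Definition coset_rel : rel G := fun x y => `[< P (x^-1 * y) >].

Lemma coset_rel_refl : reflexive coset_rel.
Proof. by move=> x; apply/asboolP; rewrite mulVg. Qed.

Lemma coset_rel_sym : symmetric coset_rel.
Proof.
suff sub x y : coset_rel x y -> coset_rel y x by move=> x y; apply/idP/idP; exact: sub.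
by move=> /asboolP/NV; rewrite invgM invgK => ?; apply/asboolP.
Qed.

Lemma coset_rel_trans : transitive coset_rel.
Proof.
move=> y x z /asboolP Nxy /asboolP Nyz; apply/asboolP.
by move: (NM Nxy Nyz); rewrite mulgA mulgK.
Qed.

Canonical coset_equiv :=
  EquivRel coset_rel coset_rel_refl coset_rel_sym coset_rel_trans.

Definition quotient_group := {eq_quot coset_rel}.
HB.instance Definition _ := Choice.on quotient_group.
HB.instance Definition _ := Quotient.on quotient_group.

Lemma eq_pi_quotient x y :
  \pi_quotient_group x = \pi_quotient_group y <-> P (x^-1 * y).
Proof.
split=> [/eqmodP/asboolP //|Nxy].
by apply/eqmodP/asboolP.
Qed.

Definition quotient_mul (a b : quotient_group) : quotient_group :=
  \pi_quotient_group (repr a * repr b).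
Definition quotient_one : quotient_group := \pi_quotient_group 1.
Definition quotient_inv (a : quotient_group) : quotient_group :=
  \pi_quotient_group (repr a)^-1.

Let repr_pi x : P (x^-1 * repr (\pi_quotient_group x)).
Proof. by apply/eq_pi_quotient; rewrite reprK. Qed.

Lemma quotient_piM x y :
  \pi_quotient_group (x * y) =
  quotient_mul (\pi_quotient_group x) (\pi_quotient_group y).
Proof.
apply/eq_pi_quotient.
move: (repr_pi x) (repr_pi y); set x' := repr _; set y' := repr _ => Nx Ny.
have -> : (x * y)^-1 * (x' * y') = (x^-1 * x') ^ y * (y^-1 * y').
  by rewrite conjgE invgM !mulgA mulgK.
by apply: NM => //; exact: NJ.
Qed.

Lemma quotient_piV x :
  \pi_quotient_group x^-1 = quotient_inv (\pi_quotient_group x).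
Proof.
apply/eq_pi_quotient; rewrite invgK.
move: (repr_pi x); set x' := repr _ => Nx.
have -> : x * x'^-1 = ((x^-1 * x')^-1) ^ x^-1.
  by rewrite conjgE invgM !invgK -!mulgA mulgV mulg1.
by apply: NJ; exact: NV.
Qed.

Let mulA : associative quotient_mul.
Proof.
move=> a b c; elim/quotW: a => x; elim/quotW: b => y; elim/quotW: c => z.
by rewrite -(quotient_piM y z) -(quotient_piM x y) -2!quotient_piM mulgA.
Qed.

Let mul1 : left_id quotient_one quotient_mul.
Proof. by elim/quotW=> x; rewrite -(quotient_piM 1 x) mul1g. Qed.

Let mulr1 : right_id quotient_one quotient_mul.
Proof. by elim/quotW=> x; rewrite -(quotient_piM x 1) mulg1. Qed.

Let mulV : left_inverse quotient_one quotient_inv quotient_mul.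
Proof. by elim/quotW=> x; rewrite -(quotient_piV x) -quotient_piM mulVg. Qed.

Let mulrV : right_inverse quotient_one quotient_inv quotient_mul.
Proof. by elim/quotW=> x; rewrite -(quotient_piV x) -quotient_piM mulgV. Qed.

HB.instance Definition _ :=
  isGroup.Build quotient_group mulA mul1 mulr1 mulV mulrV.

End Quotient.

Definition quotient_map (G : groupType) (N : normal_subgroup G) (x : G) :
  quotient_group N := (\pi_(quotient_group N) x)%qT.

Lemma quotient_mapM (G : groupType) (N : normal_subgroup G) (x y : G) :
  quotient_map N (x * y) = quotient_map N x * quotient_map N y.
Proof. exact: quotient_piM. Qed.

Lemma quotient_map_surj (G : groupType) (N : normal_subgroup G)
    (a : quotient_group N) : exists x, quotient_map N x = a.
Proof. by exists (repr a); exact: reprK. Qed.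

Lemma quotient_map_ker (G : groupType) (N : normal_subgroup G) (x : G) :
  quotient_map N x = 1 <-> normal_subgroup_set N x.
Proof.
have eta1 : quotient_map N 1 = 1.
  by apply: (@mulgI _ (quotient_map N 1)); rewrite -quotient_mapM !mulg1.
rewrite -eta1; split=> [/esym/eq_pi_quotient|Nx]; first by rewrite invg1 mul1g.
by apply/esym/eq_pi_quotient; rewrite invg1 mul1g.
Qed.

Section Presentations.
Variable X : Type.

(* Group words over X: (x, false) stands for the letter x, and (x, true) for
   its formal inverse. *)
Definition word := seq (X * bool).

(* Two words are related when they represent the same element of the abstract
   group < X | R >. *)
Inductive word_eq (R : set word) : word -> word -> Prop :=
| WordRefl w : word_eq R w w
| WordSym v w : word_eq R v w -> word_eq R w v
| WordTrans u v w : word_eq R u v -> word_eq R v w -> word_eq R u w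
| WordCat v v' w w' :
    word_eq R v v' -> word_eq R w w' -> word_eq R (v ++ w) (v' ++ w')
| WordCancel x b : word_eq R [:: (x, b); (x, ~~ b)] [::]
| WordRelator r : R r -> word_eq R r [::].

Definition eval_word (G : groupType) (f : X -> G) (w : word) : G :=
  \prod_(l <- w) (if l.2 then (f l.1)^-1 else f l.1).

(* The canonical homomorphism from < X | R > to G induced by f is defined and
   is an isomorphism. *)
Definition presented_by (G : groupType) (f : X -> G) (R : set word) : Prop :=
  (forall g : G, exists w, eval_word f w = g) /\
  (forall w, eval_word f w = 1 <-> word_eq R w [::]).

End Presentations.

Definition coxeter_matrix (X : Type) (m : X -> X -> option nat) : Prop :=
  [/\ forall s t, m s t = m t s,
      forall s t, m s t <> Some 0 &
      forall s t, m s t = Some 1%N <-> s = t].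

Definition coxeter_relators (X : Type) (m : X -> X -> option nat) :
    set (word X) :=
  [set w | exists s t k, m s t = Some k /\
             w = flatten (nseq k [:: (s, false); (t, false)])].

Definition coxeter_system_with (W : groupType) (S : set W)
    (m : S -> S -> option nat) : Prop :=
  coxeter_matrix m /\ presented_by (fun s : S => val s) (coxeter_relators m).

Definition coxeter_system (W : groupType) (S : set W) : Prop :=
  exists m : S -> S -> option nat, coxeter_system_with m.

Section Special.
Variables (X : Type) (m : X -> X -> option nat).

Definition special (a b : X) : Prop :=
  exists k, [/\ m a b = Some k, (k %% 4)%N = 2%N &
    exists v, (v = a \/ v = b) /\
      forall s, s <> a -> s <> b -> m s v <> None ->
        m s a = Some 2%N /\ m s b = Some 2].

Definition mbar (a b : X) : option nat :=
  if `[< special a b >] then Some 2%N else m a b.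

End Special.

(* d is the gcd of the finite elements of A, or None if A has none. *)
Definition is_gcd (A : set (option nat)) (d : option nat) : Prop :=
  match d with
  | Some g => [/\ exists k, A (Some k), forall k, A (Some k) -> g %| k &
                  forall e, (forall k, A (Some k) -> e %| k) -> e %| g]
  | None => forall k, ~ A (Some k)
  end.

Definition Ne (W : groupType) (S : set W) (m : S -> S -> option nat) :
    normal_subgroup W :=
  normal_closure
    ([set x | exists a b k, [/\ m a b = Some k, odd k & x = val a * val b]] `|`
     [set x | exists a b, special m a b /\ x = (val a * val b) ^+ 2]).

(* Main.v *)
From HB Require Import structures.
Require Import Defs.
From mathcomp Require Import ssralg ssrint zmodp.

Set Implicit Arguments.
Unset Strict Implicit.
Unset Printing Implicit Defensive.

Local Open Scope classical_set_scope.
Local Open Scope group_scope.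

(** Write [eta] for the quotient map.  Every relation imposed on the generators
    [eta s] of the quotient, be it a Coxeter relation of the group, an odd
    relation [eta s * eta t = 1] or a special relation
    [(eta s * eta t) ^+ 2 = 1], says that a power of some [eta s * eta t] is
    trivial.  Such a relation follows from the single one
    [(eta s * eta t) ^+ order (eta s * eta t) = 1], so the quotient is presented
    by the relations of the latter form, that is, it is a Coxeter group whose
    matrix is given by the orders ([coxeter_system_quotient]).

    To compute these orders and to separate generators, homomorphisms from the
    quotient are defined on generators ([Ne_morph]).  When a function of the
    generators takes involutions as values and is constant along odd relations,
    the remaining relations have even exponents: they hold as soon as one of the
    two values is trivial or both values agree.

    With a single nontrivial value this shows that a set of generators that is
    closed under odd relations is visible in the quotient ([class_morph]); hence
    generators have the same image if and only if they are conjugate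
    ([eta_eq_conjugate]).

    With two nontrivial values, taken on the classes of two nonconjugate
    generators [s] and [t], only the relations between these two classes remain
    to be checked.  If [e] divides all the finite [mbar u v] for [u] conjugate
    to [s] and [v] conjugate to [t], they hold for two reflections whose product
    has order [e].  So [e] divides every exponent that kills [eta s * eta t]
    ([dvdn_order]).  Since each finite [mbar u v] is such an exponent
    ([eta_mbar]), the order is their greatest common divisor.  Reading
    order zero as infinite makes this cover infinite orders too: if all the
    [mbar u v] are infinite then [e] may be zero.  Evenness is the case [e = 2]:
    an odd [mbar u v] would make [u] and [v] conjugate, hence [s] and [t]. *)

(** * Words and presentations *)

Section Words.
Variables (X : Type) (R : set (word X)).
Implicit Types (v w : word X).

Definition word_inv w : word X := rev [seq (l.1, ~~ l.2) | l <- w].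

Definition relator_word (s t : X) k : word X :=
  flatten (nseq k [:: (s, false); (t, false)]).

Lemma word_invK : involutive word_inv.
Proof.
move=> w; rewrite /word_inv map_rev revK -map_comp -[RHS]map_id.
by apply: eq_map => -[x b] /=; rewrite negbK.
Qed.

Lemma word_eq_catV w : word_eq R (w ++ word_inv w) [::].
Proof.
elim: w => [|[x b] w IHw]; first exact: WordRefl.
rewrite /word_inv /= rev_cons -cats1 catA -cat1s.
apply: WordTrans (WordCancel R x b).
rewrite -[[:: (x, b); _]]cat1s; apply: WordCat; first exact: WordRefl.
exact: (WordCat IHw (WordRefl _ [:: (x, ~~ b)])).
Qed.

Lemma word_eq_Vcat w : word_eq R (word_inv w ++ w) [::].
Proof. by rewrite -{2}[w]word_invK; exact: word_eq_catV. Qed.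

Lemma word_eq_cat1 v w :
  word_eq R v [::] -> word_eq R w [::] -> word_eq R (v ++ w) [::].
Proof. exact: WordCat. Qed.

Lemma word_eq_inv1 w : word_eq R w [::] -> word_eq R (word_inv w) [::].
Proof.
move=> w1; apply: WordTrans (word_eq_catV w); apply: WordSym.
exact: (WordCat w1 (WordRefl _ _)).
Qed.

Lemma word_eq_conj1 v w :
  word_eq R w [::] -> word_eq R (word_inv v ++ (w ++ v)) [::].
Proof.
move=> w1; apply: WordTrans (word_eq_Vcat v).
by apply: WordCat; [exact: WordRefl | exact: (WordCat w1 (WordRefl _ _))].
Qed.

End Words.

Definition word_map (X Y : Type) (h : X -> Y) (w : word X) : word Y :=
  [seq (h l.1, l.2) | l <- w].

Lemma word_map_inv (X Y : Type) (h : X -> Y) (w : word X) :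
  word_map h (word_inv w) = word_inv (word_map h w).
Proof. by rewrite /word_map /word_inv map_rev -!map_comp. Qed.

Lemma word_map_cat (X Y : Type) (h : X -> Y) (v w : word X) :
  word_map h (v ++ w) = word_map h v ++ word_map h w.
Proof. exact: map_cat. Qed.

Lemma word_map_relator (X Y : Type) (h : X -> Y) s t k :
  word_map h (relator_word s t k) = relator_word (h s) (h t) k.
Proof. by rewrite /word_map map_flatten map_nseq. Qed.

Lemma word_eq_map (X Y : Type) (h : X -> Y)
    (R : set (word X)) (R' : set (word Y)) :
    (forall r, R r -> word_eq R' (word_map h r) [::]) ->
  forall v w, word_eq R v w -> word_eq R' (word_map h v) (word_map h w).
Proof.
move=> hR v w; elim=> {v w} [w|v w _|u v w _ uv _ vw|v v' w w' _ vv _ ww|x b|r].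
- exact: WordRefl.
- exact: WordSym.
- exact: WordTrans uv vw.
- by rewrite !word_map_cat; exact: WordCat.
- exact: WordCancel.
- exact: hR.
Qed.

Section EvalWord.
Variables (X : Type) (G : groupType) (f : X -> G).
Implicit Types (v w : word X).

Lemma eval_word_nil : eval_word f [::] = 1.
Proof. exact: big_nil. Qed.

Lemma eval_word_cat v w : eval_word f (v ++ w) = eval_word f v * eval_word f w.
Proof. exact: big_cat. Qed.

Lemma eval_word1 x : eval_word f [:: (x, false)] = f x.
Proof. by rewrite /eval_word big_seq1. Qed.

Lemma eval_relator_word s t k :
  eval_word f (relator_word s t k) = (f s * f t) ^+ k.
Proof.
elim: k => [|k IHk]; first exact: big_nil.
by rewrite expgS -IHk -mulgA /eval_word /relator_word /= !big_cons.
Qed.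

Lemma eval_word_eq (R : set (word X)) :
    (forall r, R r -> eval_word f r = 1) ->
  forall v w, word_eq R v w -> eval_word f v = eval_word f w.
Proof.
move=> fR v w; elim=> {v w} [//|//|u v w _ -> _ -> //|v v' w w' _ vv _ ww|x b|r].
- by rewrite !eval_word_cat vv ww.
- by rewrite /eval_word !big_cons !big_nil; case: b; rewrite mulg1 ?mulVg ?mulgV.
- by move=> /fR ->; rewrite eval_word_nil.
Qed.

Lemma eval_word_inv w : eval_word f (word_inv w) = (eval_word f w)^-1.
Proof.
apply/esym/mulg1_eq; rewrite -eval_word_cat -eval_word_nil.
(* Cancellation uses no relators, so [f] is arbitrary. *)
exact: (@eval_word_eq set0) _ _ _ (word_eq_catV _ _).
Qed.

End EvalWord.

Lemma eval_word_morph (X Y : Type) (G H : groupType) (f : X -> G) (g : Y -> H)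
    (phi : UMagmaMorphism.type G H) (h : X -> Y) :
    (forall x, g (h x) = phi (f x)) ->
  forall w, eval_word g (word_map h w) = phi (eval_word f w).
Proof.
move=> gh w; rewrite /eval_word big_map gmulf_prod.
by apply: eq_bigr => -[x b] _ /=; rewrite gh; case: b; rewrite ?gmulfV.
Qed.

Section Presented.
Variables (X : Type) (G : groupType) (f : X -> G) (R : set (word X)).
Hypothesis GR : presented_by f R.

Lemma presented_relator r : R r -> eval_word f r = 1.
Proof. by move=> Rr; apply/GR.2; exact: WordRelator. Qed.

Lemma presented_word_eq v w : eval_word f v = eval_word f w -> word_eq R v w.
Proof.
move=> vw; have /GR.2 vw1 : eval_word f (v ++ word_inv w) = 1.
  by rewrite eval_word_cat eval_word_inv vw mulgV.
have := WordCat vw1 (WordRefl R w); rewrite -catA /=; apply: WordTrans.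
apply: WordSym; rewrite -{2}[v]cats0.
by apply: WordCat; [exact: WordRefl | exact: word_eq_Vcat].
Qed.

(** Von Dyck: the image of an element is read off from any word for it, and
    two words for the same element have the same image because they are linked
    by relators. *)
Lemma presented_morph (H : groupType) (h : X -> H) :
    (forall r, R r -> eval_word h r = 1) ->
  exists phi : UMagmaMorphism.type G H, forall x, phi (f x) = h x.
Proof.
move=> hR; pose w_ g := sval (cid (GR.1 g)).
have w_K g : eval_word f (w_ g) = g := svalP (cid (GR.1 g)).
have evalE w g : eval_word f w = g -> eval_word h (w_ g) = eval_word h w.
  by move=> <-; apply/(eval_word_eq hR)/presented_word_eq/w_K.
pose phi g := eval_word h (w_ g).
have phiM : {morph phi : x y / x * y}.
  move=> x y; rewrite /phi -eval_word_cat; apply: evalE.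
  by rewrite eval_word_cat !w_K.
have phi1 : phi 1 = 1.
  by rewrite /phi (evalE [::]) eval_word_nil.
pose phi_mor := isUMagmaMorphism.Build G H phi (phi1, phiM).
pose Phi : UMagmaMorphism.type G H := HB.pack phi phi_mor.
exists Phi => x; rewrite -[RHS](eval_word1 h); apply: evalE; exact: eval_word1.
Qed.

End Presented.

(** * Normal closures and quotients *)

HB.instance Definition _ (G : groupType) (N : normal_subgroup G) :=
  isUMagmaMorphism.Build G (quotient_group N) (@quotient_map G N)
    (erefl, @quotient_mapM G N).

Lemma normal_closure_sub (G : groupType) (A : set G) : A `<=` normal_closure A.
Proof. exact: sub_smallest. Qed.

Lemma normal_closure_min (G : groupType) (A N : set G) :
  normal N -> A `<=` N -> normal_closure A `<=` N.
Proof. exact: smallest_sub. Qed.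

Lemma normal_kernel (G H : groupType) (phi : UMagmaMorphism.type G H) :
  normal [set x | phi x = 1].
Proof.
split; first split=> [|x y /set_mem /= x1 /set_mem /= y1]; rewrite ?inE /=.
- exact: gmulf1.
- by rewrite gmulfF x1 y1 divg1.
- by move=> x y /= x1; rewrite gmulfJ x1 conj1g.
Qed.

Lemma quotient_map_eq (G : groupType) (A : set G) (H : groupType)
    (phi : UMagmaMorphism.type G H) x y :
    (forall a, A a -> phi a = 1) ->
    quotient_map (normal_closure A) x = quotient_map (normal_closure A) y ->
  phi x = phi y.
Proof.
move=> phiA /(congr1 (fun a => a / quotient_map _ y)).
rewrite mulgV -gmulfF => /quotient_map_ker /(normal_closure_min (normal_kernel phi) phiA).
by rewrite /= gmulfF => /divg1_eq.
Qed.

(** A presentation of the quotient by the normal closure of [A], on a set of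
    generators where some of the old ones may become identified: it is enough
    that the new relators hold in the quotient and imply both the old ones and
    the triviality of each element of [A].  The elements of [G] that have a word
    trivialized by the new relators form a normal subgroup, so it contains the
    normal closure as soon as it contains [A]. *)
Lemma presented_quotient (X Y : Type) (G : groupType) (f : X -> G)
    (R : set (word X)) (A : set G) (h : X -> Y)
    (g : Y -> quotient_group (normal_closure A)) (R' : set (word Y)) :
    presented_by f R ->
    (forall y, exists x, h x = y) ->
    (forall x, g (h x) = quotient_map (normal_closure A) (f x)) ->
    (forall r, R' r -> eval_word g r = 1) ->
    (forall r, R r -> word_eq R' (word_map h r) [::]) ->
    (forall a, A a -> exists2 w, eval_word f w = a & word_eq R' (word_map h w) [::]) ->
  presented_by g R'.
Proof.
move=> GR h_surj gh gR' RR' AR'.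
have evalM w : eval_word g (word_map h w) = quotient_map _ (eval_word f w).
  exact: eval_word_morph.
pose K := [set x | exists2 w, eval_word f w = x & word_eq R' (word_map h w) [::]].
have K_normal : normal K.
  split; first split.
  - apply/mem_set; exists [::]; [exact: eval_word_nil | exact: WordRefl].
  - move=> x y /set_mem[v <- v1] /set_mem[w <- w1]; apply/mem_set.
    exists (v ++ word_inv w); first by rewrite eval_word_cat eval_word_inv.
    rewrite word_map_cat word_map_inv.
    by apply: word_eq_cat1 => //; exact: word_eq_inv1.
  - move=> x y [w <- w1]; have [v <-] := GR.1 y.
    exists (word_inv v ++ (w ++ v)).
      by rewrite !eval_word_cat eval_word_inv.
    by rewrite !word_map_cat word_map_inv; exact: word_eq_conj1.
split=> [a|w].
  have [x <-] := quotient_map_surj a; have [w <-] := GR.1 x.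
  by exists (word_map h w).
split=> [|/(eval_word_eq gR')]; last by rewrite eval_word_nil.
have [v ->] : exists v, w = word_map h v.
  elim: w => [|[y b] w [v ->]]; first by exists [::].
  by have [x <-] := h_surj y; exists ((x, b) :: v).
rewrite evalM => /quotient_map_ker /(normal_closure_min K_normal AR')[u uv u1].
by apply: WordTrans u1; apply/(word_eq_map RR')/(presented_word_eq GR).
Qed.

(** * Orders of elements *)

Section Order.
Variable G : groupType.
Implicit Types x y : G.

Lemma order_None x : order x = None -> forall k, x ^+ k = 1 -> k = 0%N.
Proof.
rewrite /order; case: pselect => // nx _ [//|k] xk.
by case: nx; exists k.+1; rewrite xk eqxx.
Qed.

Lemma order_Some x n :
  order x = Some n -> (0 < n)%N /\ forall k, x ^+ k = 1 <-> n %| k.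
Proof.
rewrite /order; case: pselect => // ex_n [<-].
case: ex_minnP => {}n /andP[n_gt0 /eqP xn] n_min; split=> // k.
split=> [xk|/dvdnP[q ->]]; last by rewrite mulnC expgnA xn expg1n.
have xkn : x ^+ (k %% n) = 1.
  by move: xk; rewrite {1}(divn_eq k n) expgnDr mulnC expgnA xn expg1n mul1g.
rewrite /dvdn -leqn0 leqNgt; apply/negP => kn_gt0.
have := n_min (k %% n)%N; rewrite kn_gt0 xkn eqxx => /(_ isT).
by rewrite leqNgt ltn_mod n_gt0.
Qed.

Lemma eq_order x y : (forall k, x ^+ k = 1 <-> y ^+ k = 1) -> order x = order y.
Proof.
move=> xy; case ox: (order x) => [a|]; case oy: (order y) => [b|] //.
- have [[_ ax] [_ by_]] := (order_Some ox, order_Some oy).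
  congr Some; apply/eqP; rewrite eqn_dvd; apply/andP; split.
    by apply/ax/xy/by_.
  by apply/by_/xy/ax.
- have [a_gt0 ax] := order_Some ox.
  by move: (order_None oy (k := a)) a_gt0 => ->//; apply/xy/ax.
- have [b_gt0 by_] := order_Some oy.
  by move: (order_None ox (k := b)) b_gt0 => ->//; apply/xy/by_.
Qed.

Lemma order_eq1 x : order x = Some 1%N <-> x = 1.
Proof.
split=> [/order_Some[_ x1]|->]; first by rewrite -[x]expg1; apply/x1.
case o1: (order 1) => [n|].
  by have [_ /(_ 1%N)[]] := order_Some o1; rewrite dvdn1 => /(_ erefl)/eqP->.
by have := order_None o1 (expg1n _ 1).
Qed.

End Order.

(** * Products of two involutions *)

Section Involutions.
Variables (G : groupType) (a b : G).
Hypotheses (a2 : a * a = 1) (b2 : b * b = 1).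

Lemma involution_inv : a^-1 = a.
Proof. exact: mulg1_eq. Qed.

Lemma involution_mul_eq1 : a * b = 1 <-> a = b.
Proof.
split=> [/mulg1_eq <-|<-//]; by rewrite involution_inv.
Qed.

Lemma involution_mulC_exp k : (a * b) ^+ k = 1 -> (b * a) ^+ k = 1.
Proof.
move=> abk; have -> : b * a = (a * b)^-1.
  by rewrite invgM involution_inv (mulg1_eq b2).
by rewrite expVgn abk invg1.
Qed.

(** With [c = a * b], inversion of [c] by [a] gives
    [a ^ (c ^+ j.+1) = c ^- (2 * j.+1) * a], which is [c^-1 * a = b] when
    [c ^+ j.*2.+1 = 1]. *)
Lemma odd_conjugate k : odd k -> (a * b) ^+ k = 1 -> conjugate a b.
Proof.
move=> k_odd; rewrite -[k]odd_double_half k_odd add1n -addnn.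
set j := k./2; set c := a * b => ck.
have ac n : a * c ^+ n = c ^- n * a.
  have ca : c ^ a^-1 = c^-1.
    by rewrite conjgE invgK invgM involution_inv (mulg1_eq b2) /c !mulgA a2 mul1g.
  by rewrite conjgCV conjXg ca expVgn.
exists (c ^+ j.+1); apply: (@mulgI _ (c ^+ j.+1)); rewrite -conjgC ac.
have -> : c ^- j.+1 = c ^+ j.
  by apply: mulg1_eq; rewrite -expgnDr addSn.
by rewrite expgSr {3}/c -mulgA -[a * b * b]mulgA b2 mulg1.
Qed.

End Involutions.

(** * Dihedral groups *)

(** The semidirect product of an additive group [A] with the group of order two
    acting by negation. *)
Definition dihedral (A : zmodType) : Type := (A * bool)%type.

Section Dihedral.
Import GRing.Theory.
Local Open Scope ring_scope.
Variable A : zmodType.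
Local Notation D := (dihedral A).
HB.instance Definition _ := Choice.on D.

Let flip (b : bool) (a : A) := if b then - a else a.
Let mul (x y : D) : D := (x.1 + flip x.2 y.1, x.2 (+) y.2).
Let one : D := (0, false).
Let inv (x : D) : D := (- flip x.2 x.1, x.2).

Let mulA : associative mul.
Proof.
move=> [a []] [b []] [c d]; rewrite /mul /=;
  by congr pair; rewrite ?opprD ?opprK ?addrA ?negbK.
Qed.
Let mul1 : left_id one mul.
Proof. by case=> a b; rewrite /mul /= add0r. Qed.
Let mulr1 : right_id one mul.
Proof. by case=> a []; rewrite /mul /= ?oppr0 addr0. Qed.
Let mulV : left_inverse one inv mul.
Proof. by case=> a []; rewrite /mul /inv /one /= ?opprK ?subrr ?addNr. Qed.
Let mulrV : right_inverse one inv mul.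
Proof. by case=> a []; rewrite /mul /inv /one /= ?opprK subrr. Qed.

HB.instance Definition _ := isGroup.Build D mulA mul1 mulr1 mulV mulrV.

Definition reflection (a : A) : D := (a, true).

Lemma reflection_sq a : (reflection a * reflection a)%g = 1%g.
Proof. by congr (_, _); rewrite /= subrr. Qed.

Lemma reflectionM_exp (a : A) k :
  ((reflection a * reflection 0) ^+ k)%g = 1%g <-> a *+ k = 0.
Proof.
have -> : ((reflection a * reflection 0) ^+ k)%g = (a *+ k, false) :> D.
  elim: k => [//|k IHk]; rewrite expgS IHk mulrS.
  by congr (_, _); rewrite /= oppr0 addr0.
by split=> [[]|->].
Qed.

End Dihedral.

(** The element [a] has order [e], infinite when [e] is zero; this convention
    allows finite and infinite dihedral groups to be used at once. *)
Lemma cyclic_zmod e :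
  exists (A : zmodType) (a : A), forall k, (a *+ k)%R = 0%R <-> e %| k.
Proof.
case: e => [|n].
  exists int, 1%R => k; rewrite dvd0n; split=> [|/eqP->//].
  by rewrite natz => -[->].
exists 'I_n.+1, (inZp 1) => k.
rewrite Zp_mulrn; split=> [/(congr1 val)/=|/dvdnP[q ->]].
  by rewrite modnMml mul1n => /eqP.
by apply: val_inj; rewrite /= modnMml mul1n modnMl.
Qed.

(** * Quotients of Coxeter groups *)

Lemma special_sym (X : Type) (m : X -> X -> option nat) a b :
  (forall s t, m s t = m t s) -> special m a b -> special m b a.
Proof.
move=> mC [k [mab k2 [v [vab sv]]]].
exists k; split=> //; first by rewrite mC.
exists v; split; first by case: vab; [right | left].
by move=> s sb sa smv; have [] := sv s sa sb smv.
Qed.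

Section CoxeterQuotient.
Variables (W : groupType) (S : set W) (m : S -> S -> option nat).
Hypothesis WS : coxeter_system_with m.
Implicit Types s t u v : S.

Let mC s t : m s t = m t s. Proof. by case: WS => -[]. Qed.
Let m_neq0 s t : m s t <> Some 0. Proof. by case: WS => -[]. Qed.
Let m1 s : m s s = Some 1%N. Proof. by case: WS => -[_ _ m1] _; exact/m1. Qed.
Let pres : presented_by (fun s : S => val s) (coxeter_relators m).
Proof. by case: WS. Qed.

Local Notation eta := (quotient_map (Ne m)).

Lemma coxeter_order s t k : m s t = Some k -> (val s * val t) ^+ k = 1.
Proof.
move=> mst; have := eval_relator_word (fun s : S => val s) s t k.
by move=> <-; apply: (presented_relator pres); exists s, t, k.
Qed.

Lemma coxeter_invol s : val s * val s = 1.
Proof. by have := coxeter_order (m1 s); rewrite expg1. Qed.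

Lemma eta_invol s : eta (val s) * eta (val s) = 1.
Proof. by rewrite -gmulfM coxeter_invol gmulf1. Qed.

Lemma eta_odd s t k : m s t = Some k -> odd k -> eta (val s) = eta (val t).
Proof.
move=> mst k_odd; apply/(involution_mul_eq1 _ (eta_invol s)).
rewrite -gmulfM; apply/quotient_map_ker; apply: normal_closure_sub.
by left; exists s, t, k.
Qed.

Lemma eta_mbar s t k : mbar m s t = Some k -> (eta (val s) * eta (val t)) ^+ k = 1.
Proof.
rewrite -gmulfM -gmulfXn /mbar; case: asboolP => [st [<-]|_ /coxeter_order ->].
  by apply/quotient_map_ker; apply: normal_closure_sub; right; exists s, t.
exact: gmulf1.
Qed.

Lemma mbar_gt0 s t k : mbar m s t = Some k -> (0 < k)%N.
Proof.
rewrite /mbar; case: asboolP => [_ [<-] //|_ mst]; rewrite lt0n.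
by apply/eqP => k0; case: (@m_neq0 s t); rewrite mst k0.
Qed.

(** The universal property of the quotient by [Ne m].  For involutions, the
    odd relation [h s * h t = 1] amounts to the equality [h s = h t]. *)
Lemma Ne_morph (G : groupType) (h : S -> G) :
    (forall s, h s * h s = 1) ->
    (forall s t k, m s t = Some k -> odd k -> h s = h t) ->
    (forall s t k, m s t = Some k -> ~~ odd k -> (h s * h t) ^+ k = 1) ->
    (forall s t, special m s t -> (h s * h t) ^+ 2 = 1) ->
  exists2 phi : UMagmaMorphism.type W G, forall s, phi (val s) = h s &
    forall x y, eta x = eta y -> phi x = phi y.
Proof.
move=> h2 h_odd h_even h_special.
have [r [s [t [k [mst ->]]]]|phi phiE] := @presented_morph _ _ _ _ pres G h.
  rewrite -/(relator_word s t k) eval_relator_word.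
  have [k_odd|] := boolP (odd k); last exact: h_even.
  by rewrite (h_odd _ _ _ mst k_odd) h2 expg1n.
exists phi => // x y; apply: quotient_map_eq => a [].
  move=> [s [t [k [mst k_odd ->]]]].
  by rewrite gmulfM !phiE (h_odd _ _ _ mst k_odd) h2.
by move=> [s [t [st ->]]]; rewrite gmulfXn gmulfM !phiE; exact: h_special.
Qed.

(** A set [P] of generators that is closed under odd relations is detected by
    the homomorphism to a group of order two that maps it to the nontrivial
    element and the other generators to one: the remaining relations have even
    exponents.  The group of order two is taken inside the infinite dihedral
    group. *)
Lemma class_morph (P : S -> Prop) :
    (forall s t k, m s t = Some k -> odd k -> P s <-> P t) ->
  exists (G : groupType) (phi : UMagmaMorphism.type W G),
    (forall s, phi (val s) = 1 <-> ~ P s) /\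
    forall x y, eta x = eta y -> phi x = phi y.
Proof.
move=> P_odd; pose rho : dihedral int := reflection 0%R.
pose h s := if `[< P s >] then rho else 1.
have h2 s t : (h s * h t) ^+ 2 = 1.
  rewrite /h; case: asboolP => _; case: asboolP => _;
    by rewrite ?mulg1 ?mul1g expg2 ?reflection_sq ?mulg1.
have [||||phi phiE phi_eta] := @Ne_morph _ h.
- by move=> s; rewrite /h; case: asboolP => _; rewrite ?reflection_sq ?mulg1.
- by move=> s t k mst k_odd; rewrite /h (asbool_equiv_eq (P_odd _ _ _ mst k_odd)).
- move=> s t k _ k_even; rewrite -[k]odd_double_half (negPf k_even) add0n.
  by rewrite -mul2n expgnA h2 expg1n.
- by [].
exists (dihedral int), phi; split=> // s.
by rewrite phiE /h; case: asboolP.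
Qed.

(** If [eta s] and [eta t] differ then the homomorphism of [class_morph] for
    the fibre of [eta s] separates the conjugacy classes of [s] and [t].
    Conversely the conjugacy class of [s] is closed under odd relations by
    [odd_conjugate], and the homomorphism that it defines factors through
    [eta]. *)
Lemma eta_eq_conjugate s t :
  eta (val s) = eta (val t) <-> conjugate (val s) (val t).
Proof.
split=> [st|[x sxt]].
  have [u v k muv k_odd|G [phi [phiP phi_eta]]] :=
      @class_morph (fun u => conjugate (val s) (val u)).
    have [x uxv] : conjugate (val u) (val v).
      apply: odd_conjugate (coxeter_invol u) (coxeter_invol v) _ k_odd _.
      exact: coxeter_order.
    split=> [[y syu]|[y syv]]; first by exists (y * x); rewrite conjgM syu.
    by exists (y * x^-1); rewrite conjgM syv -uxv conjgK.
  apply: contrapT => /phiP; rewrite -(phi_eta _ _ st) => /phiP; apply.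
  by exists 1; rewrite conjg1.
have [u v k muv k_odd|G [phi [phiP phi_eta]]] :=
    @class_morph (fun u => eta (val u) = eta (val s)).
  by rewrite (eta_odd muv k_odd).
apply/esym; apply: contrapT => /phiP; rewrite -sxt gmulfJ => /eqP.
by rewrite conjg_eq1 => /eqP/phiP; apply.
Qed.

(** Lower bound on the order: map the classes of [s] and of [t] to two
    reflections of a dihedral group whose product has order [e], and the other
    generators to one.  Odd relations link generators of
    the same class.  The other relations have even exponents, so they hold
    between the images except possibly when the two generators come one from
    each class; then [e] divides the exponent. *)
Lemma dvdn_order s t e g :
    ~ conjugate (val s) (val t) ->
    (forall u v k, conjugate (val u) (val s) -> conjugate (val v) (val t) ->
      mbar m u v = Some k -> e %| k) ->
  (eta (val s) * eta (val t)) ^+ g = 1 -> e %| g.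
Proof.
move=> st e_dvd; have [A [a aP]] := cyclic_zmod e.
have mbar_e u v k :
    eta (val u) = eta (val s) -> eta (val v) = eta (val t) ->
    mbar m u v = Some k -> (a *+ k)%R = 0%R.
  move=> /eta_eq_conjugate us /eta_eq_conjugate vt uvk.
  by apply/aP; exact: e_dvd uvk.
pose rs : dihedral A := reflection a; pose rt : dihedral A := reflection 0%R.
pose h u := if `[< eta (val u) = eta (val s) >] then rs
            else if `[< eta (val u) = eta (val t) >] then rt else 1.
have h2 u : h u * h u = 1.
  by rewrite /h; do 2?case: asboolP => _; rewrite ?reflection_sq ?mulg1.
have hM u v k : ~~ odd k ->
    (eta (val u) = eta (val s) -> eta (val v) = eta (val t) -> (a *+ k)%R = 0%R) ->
    (eta (val v) = eta (val s) -> eta (val u) = eta (val t) -> (a *+ k)%R = 0%R) ->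
  (h u * h v) ^+ k = 1.
  move=> k_even uv vu.
  have [<-|huv] := eqVneq (h u) (h v); first by rewrite h2 expg1n.
  have even1 x : x * x = 1 -> x ^+ k = 1 :> dihedral A.
    move=> x2; rewrite -[k]odd_double_half (negPf k_even) add0n -mul2n expgnA.
    by rewrite expg2 x2 expg1n.
  have := h2 u; have := h2 v; move: huv; rewrite /h.
  case: asboolP => us; case: asboolP => vs; rewrite ?eqxx //;
    do ?[case: asboolP => ?]; rewrite ?eqxx // => _ v2 u2;
    rewrite ?mul1g ?mulg1; try exact: even1.
  - by apply/reflectionM_exp/uv.
  - by apply: involution_mulC_exp => //; apply/reflectionM_exp/vu.
have [||||phi phiE phi_eta] := @Ne_morph _ h.
- exact: h2.
- by move=> u v k muv k_odd; rewrite /h (eta_odd muv k_odd).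
- have rot u v k : m u v = Some k -> ~~ odd k ->
      eta (val u) = eta (val s) -> eta (val v) = eta (val t) -> (a *+ k)%R = 0%R.
    move=> muv k_even us vt; have := mbar_e u v _ us vt; rewrite /mbar.
    case: asboolP => _; last exact.
    move=> /(_ _ erefl) /aP e2; apply/aP; apply: dvdn_trans e2 _.
    by rewrite dvdn2.
  move=> u v k muv k_even; apply: hM => // [|vs ut]; first exact: rot.
  by apply: (rot v u) => //; rewrite mC.
- have rot u v : special m u v ->
      eta (val u) = eta (val s) -> eta (val v) = eta (val t) -> (a *+ 2)%R = 0%R.
    by move=> /asboolP uv us vt; apply: (mbar_e u v) => //; rewrite /mbar uv.
  move=> u v uv; apply: hM => // [|vs ut]; first exact: rot.
  by apply: (rot v u) => //; exact: special_sym.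
move=> stg; apply/aP/reflectionM_exp; rewrite -/rs -/rt.
have -> : rs = phi (val s) by rewrite phiE /h; case: asboolP.
have -> : rt = phi (val t).
  rewrite phiE /h; case: asboolP => [/esym/eta_eq_conjugate //|_].
  by case: asboolP.
rewrite -gmulfM -gmulfXn -[RHS](@gmulf1 _ _ phi); apply: phi_eta.
by rewrite gmulfXn gmulfM stg gmulf1.
Qed.

Lemma is_gcd_order s t : ~ conjugate (val s) (val t) ->
  is_gcd [set d | exists u v : S,
            [/\ conjugate (val u) (val s), conjugate (val v) (val t) &
                d = mbar m u v]]
         (order (eta (val s) * eta (val t))).
Proof.
move=> st; set A := [set d | _].
have A_exp k : A (Some k) -> (eta (val s) * eta (val t)) ^+ k = 1.
  move=> [u [v [/eta_eq_conjugate <- /eta_eq_conjugate <- uvk]]].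
  exact: eta_mbar.
have dvd_exp e g : (forall k, A (Some k) -> e %| k) ->
    (eta (val s) * eta (val t)) ^+ g = 1 -> e %| g.
  move=> eA; apply: dvdn_order => // u v k us vt uvk.
  by apply: eA; exists u, v.
case ost: (order _) => [g|] /=.
  have [g_gt0 gP] := order_Some ost.
  have g1 : (eta (val s) * eta (val t)) ^+ g = 1 by apply/gP.
  split=> [|k /A_exp/gP //|e eA]; last exact: dvd_exp eA g1.
  (* With no finite element in [A], zero would divide all of them, and so [g]. *)
  apply: contrapT => noA; move: g_gt0; suff /(_ 0%N) : forall e, e %| g.
    by rewrite dvd0n => /eqP->.
  by move=> e; apply: dvd_exp g1 => k Ak; case: noA; exists k.
move=> k Ak; have k0 := order_None ost (A_exp _ Ak).
by case: Ak => u [v [_ _ /esym/mbar_gt0]]; rewrite k0.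
Qed.

Lemma even_order s t : ~ conjugate (val s) (val t) ->
  order (eta (val s) * eta (val t)) = None \/
  exists k, order (eta (val s) * eta (val t)) = Some k /\ ~~ odd k.
Proof.
move=> st; case ost: (order _) => [g|]; [right | by left].
exists g; split=> //; rewrite -dvdn2.
have [_ gP] := order_Some ost.
apply: (dvdn_order st); last exact/gP.
move=> u v k us vt; rewrite /mbar dvdn2.
case: asboolP => [_ [<-] //|_ muv]; apply/negP => k_odd; apply: st.
move: us vt; rewrite -!eta_eq_conjugate => <- <-; exact: eta_odd muv k_odd.
Qed.

(** The exponents of the relations imposed on [eta s * eta t] are multiples of
    its order, so these relations follow from the one given by the order. *)
Lemma coxeter_system_quotient :
  coxeter_system (eta @` S : set (quotient_group (Ne m))).
Proof.
set Se := eta @` S; pose me (x y : Se) := order (val x * val y).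
pose h s : Se := SigSub (mem_set (imageP eta (set_valP s))).
have h_surj x : exists s, h s = x.
  have [w Sw wx] := set_valP x.
  by exists (SigSub (mem_set Sw)); exact: val_inj.
have Se2 (x : Se) : val x * val x = 1.
  by have [s <-] := h_surj x; exact: eta_invol.
exists me; split.
  split=> [x y|x y|x y]; rewrite /me.
  - by apply: eq_order => k; split; exact: involution_mulC_exp.
  - by move=> /order_Some[].
  - by rewrite order_eq1 (involution_mul_eq1 _ (Se2 x)); split=> [/val_inj|->].
have relator s t k : (eta (val s) * eta (val t)) ^+ k = 1 ->
    word_eq (coxeter_relators me) (word_map h (relator_word s t k)) [::].
  rewrite word_map_relator; case ost: (me (h s) (h t)) => [n|]; last first.
    by move=> /(order_None ost) ->; exact: WordRefl.
  have [_ nP] := order_Some ost => /nP/dvdnP[q ->].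
  elim: q => [|q IHq]; first exact: WordRefl.
  rewrite mulSn /relator_word nseqD flatten_cat; apply: word_eq_cat1 => //.
  by apply: WordRelator; exists (h s), (h t), n.
apply: (presented_quotient (h := h) pres) => //.
- move=> r [x [y [k [xyk ->]]]]; rewrite -/(relator_word x y k).
  by rewrite eval_relator_word; have [_ kP] := order_Some xyk; apply/kP.
- move=> r [s [t [k [mst ->]]]]; rewrite -/(relator_word s t k).
  by apply: relator; rewrite -gmulfM -gmulfXn (coxeter_order mst) gmulf1.
- move=> x [[s [t [k [mst k_odd ->]]]]|[s [t [st ->]]]].
    exists (relator_word s t 1); first exact: eval_relator_word.
    by apply: relator; rewrite (eta_odd mst k_odd) expg1 eta_invol.
  exists (relator_word s t 2); first exact: eval_relator_word.
  by apply: relator; apply: eta_mbar; rewrite /mbar asboolT.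
Qed.

End CoxeterQuotient.

Theorem proposition6p1 (W : groupType) (S : set W)
    (m : S -> S -> option nat) (finS : finite_set S)
    (WS : coxeter_system_with m) :
  let We := quotient_group (Ne m) in
  let eta : W -> We := quotient_map (Ne m) in
  let Se : set We := eta @` S in
  [/\ coxeter_system Se,
      forall s t : S, eta (val s) = eta (val t) <-> conjugate (val s) (val t),
      forall s t : S, ~ conjugate (val s) (val t) ->
        is_gcd [set d | exists u v : S,
                  [/\ conjugate (val u) (val s), conjugate (val v) (val t) &
                      d = mbar m u v]]
               (order (eta (val s) * eta (val t))) &
      forall s t : S, ~ conjugate (val s) (val t) ->
        order (eta (val s) * eta (val t)) = None \/
        exists k, order (eta (val s) * eta (val t)) = Some k /\ ~~ odd k].
Proof.
move=> We eta Se; split.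
- exact: coxeter_system_quotient.
- exact: eta_eq_conjugate.
- exact: is_gcd_order.
- exact: even_order.
Qed.
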